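(* Let $L$ be a loop, let $K$ be a real number, and let $A,B\subseteq L$ be finite nonempty subsets. If $|AB|\le K|B|$, then there exists a subset $X\subseteq A$ with $|X|\le K$ such that $A\subseteq\bigcup_{x\in X}(xB)/B$.
   Context: A loop is a set with a binary operation having a two-sided identity $1$ such that for all $a,b$ the equations $ax=b$ and $ya=b$ have unique solutions. For $u,v$ in a loop, $u/v$ denotes the unique $y$ with $yv=u$. For subsets $U,V$ of a loop, $UV=\{uv:u\in U,v\in V\}$ and $U/V=\{u/v:u\in U,v\in V\}$; $xB=\{xb:b\in B\}$. *)

(* Defs.v *)
From HB Require Import structures.
From mathcomp Require Import all_boot all_order all_algebra.
From mathcomp Require Import finmap reals.

Set Implicit Arguments.
Unset Strict Implicit.
Unset Printing Implicit Defensive.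

Local Open Scope group_scope.
Local Open Scope fset_scope.

HB.mixin Record UMagma_isLoop L of UMagma L := {
  loop_ldiv_exuniq : forall a b : L, exists! x, a * x = b;
  loop_rdiv_exuniq : forall a b : L, exists! y, y * a = b
}.

#[short(type="loopType")]
HB.structure Definition Loop := {L of UMagma_isLoop L & UMagma L}.

Section LoopDivision.
Variable L : loopType.
Implicit Types u v y : L.

Fact rdiv_subproof u v : exists y, y * v == u.
Proof. by have [y [yv _]] := loop_rdiv_exuniq v u; exists y; apply/eqP. Qed.

(* This is not the notation u / v of group_scope, which means u * v^-1. *)
Definition rdiv u v : L := xchoose (rdiv_subproof u v).

Lemma rdivK u v : rdiv u v * v = u.
Proof. exact/eqP/(xchooseP (rdiv_subproof u v)). Qed.

Lemma rdiv_unique u v y : y * v = u -> y = rdiv u v.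
Proof.
move=> yv; have [z [_ z_uniq]] := loop_rdiv_exuniq v u.
by rewrite -(z_uniq _ yv) -(z_uniq _ (rdivK u v)).
Qed.

End LoopDivision.

Section FiniteSubsets.
Variable L : loopType.
Implicit Types (x : L) (U V B : {fset L}).

Definition fset_mul U V : {fset L} := [fset u * v | u in U, v in V].

Definition fset_rdiv U V : {fset L} := [fset rdiv u v | u in U, v in V].

Definition fset_ltrans x B : {fset L} := [fset x * b | b in B].

End FiniteSubsets.

(* Main.v *)
(* Greedily choose X inside A so that the translates xB, x in X, are pairwise
   disjoint and no further translate aB with a in A can be added. Left
   translations being injective, |X||B| = |XB| <= |AB| <= K|B|. By maximality
   every aB meets some xB, and ab = xb' says a = (xb')/b. *)
Require Import Defs.
From mathcomp Require Import all_boot all_order all_algebra.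
From mathcomp Require Import finmap reals.

Local Open Scope fset_scope.
Local Open Scope ring_scope.

Lemma loop_mulI (L : loopType) (x : L) : injective (fun y : L => (x * y)%g).
Proof.
move=> y z /= exy; have [t [_ t_uniq]] := loop_ldiv_exuniq x (x * z)%g.
by rewrite -(t_uniq y exy) -(t_uniq z erefl).
Qed.

Lemma card_fset_ltrans (L : loopType) (x : L) (B : {fset L}) :
  #|` fset_ltrans x B| = #|` B|.
Proof. by rewrite card_imfset //; apply: loop_mulI. Qed.

Lemma fset_mulSl (L : loopType) (U V B : {fset L}) :
  U `<=` V -> fset_mul U B `<=` fset_mul V B.
Proof.
move=> /fsubsetP sUV; apply/fsubsetP => _ /imfset2P[u uU [b bB ->]].
by apply: in_imfset2 => //; apply: sUV.
Qed.

Lemma fset_ltrans_subl (L : loopType) (x : L) (U B : {fset L}) :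
  x \in U -> fset_ltrans x B `<=` fset_mul U B.
Proof.
by move=> xU; apply/fsubsetP => _ /imfsetP[b bB ->]; apply: in_imfset2.
Qed.

(** Uniqueness of right division does it. This serves both an element left out of [X], whose
    translate meets [fset_mul X B], and an element put into [X]. *)
Lemma in_bigcup_rdiv (L : loopType) (X B : {fset L}) (a b : L) :
  b \in B -> (a * b)%g \in fset_mul X B ->
  a \in \bigcup_(x <- X) fset_rdiv (fset_ltrans x B) B.
Proof.
move=> bB /imfset2P[x xX [c cB eab]]; apply/bigfcupP; exists x; rewrite ?xX//.
by rewrite (rdiv_unique eab); apply: in_imfset2 => //; apply: in_imfset.
Qed.

(* The cardinality bound encodes pairwise disjointness of the translates. *)
Lemma exists_disjoint_translates (L : loopType) (A B : {fset L}) :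
  B != fset0 ->
  exists X : {fset L},
    [/\ X `<=` A,
        (#|` X| * #|` B| <= #|` fset_mul X B|)%N
      & A `<=` \bigcup_(x <- X) fset_rdiv (fset_ltrans x B) B].
Proof.
move=> /fset0Pn[b0 b0B].
(* The greedy choice becomes strong induction on [A]: solve for [A] without [a], then add [a] to [X]
   only if its translate is disjoint from [fset_mul X B]. *)
elim/finSet_rect: A => A IH; have [->|[a aA]] := fset_0Vmem A.
  by exists fset0; split; rewrite ?fsub0set// cardfs0.
have [X [sXA leX /fsubsetP covX]] := IH _ (fproperD1 aA).
have sX : X `<=` A by apply: fsubset_trans sXA (fsubD1set _ _).
have [disj|] := boolP [disjoint fset_ltrans a B & fset_mul X B]%fset; last first.
  move=> /fset0Pn[_ /fsetIP[/imfsetP[b /= bB ->] abX]].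
  exists X; split=> //; apply/fsubsetP => c cA.
  have [->|ca] := eqVneq c a; first exact: in_bigcup_rdiv abX.
  by apply: covX; rewrite !inE ca.
have aX : a \notin X.
  by apply/negP => /(fsubsetP sXA); rewrite !inE eqxx.
exists (a |` X); split.
- by rewrite fsubUset fsub1set aA.
- rewrite cardfsU1 aX mulnDl mul1n.
  apply: (@leq_trans #|` fset_ltrans a B `|` fset_mul X B|).
    by rewrite cardfsU (eqP disj) cardfs0 subn0 card_fset_ltrans leq_add2l.
  apply: fsubset_leq_card; rewrite fsubUset fset_mulSl ?fsubsetUr// andbT.
  by apply: fset_ltrans_subl; rewrite !inE eqxx.
- apply/fsubsetP => c cA; have [->|ca] := eqVneq c a.
    (* The new element covers itself, as the quotient of [a * b0] by [b0]. *)
    by apply: (in_bigcup_rdiv _ _ _ _ _ b0B); apply: in_imfset2;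
      rewrite //= !inE eqxx.
  have /bigfcupP[x /andP[xX _] cx] :
    c \in \bigcup_(x <- X) fset_rdiv (fset_ltrans x B) B.
    by apply: covX; rewrite !inE ca.
  by apply/bigfcupP; exists x; rewrite // !inE xX orbT.
Qed.

Theorem proposition3p13 (R : realType) (L : loopType) (K : R) (A B : {fset L})
    (A_neq0 : A != fset0) (B_neq0 : B != fset0)
    (leAB : (#|` fset_mul A B|)%:R <= K * (#|` B|)%:R) :
  exists X : {fset L},
    [/\ X `<=` A,
        (#|` X|)%:R <= K
      & A `<=` \bigcup_(x <- X) fset_rdiv (fset_ltrans x B) B].
Proof.
have [X [sXA leX covX]] := exists_disjoint_translates L A B B_neq0.
exists X; split=> //.
have B_gt0 : 0 < (#|` B|)%:R :> R by rewrite Num.Theory.ltr0n cardfs_gt0.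
(* Scaling by the size of [B] leaves a comparison of natural numbers, with [fset_mul X B] in
   between. *)
rewrite -(Num.Theory.ler_pM2r B_gt0) -GRing.natrM.
apply: Order.POrderTheory.le_trans leAB; rewrite Num.Theory.ler_nat.
by apply: leq_trans leX _; apply/fsubset_leq_card/fset_mulSl.
Qed.
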